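(* Let $(X,d)$ be a complete separable metric space with a fixed dense sequence $(x_i)_{i\in\mathbb{N}}$, let $T\colon X\to X$ be continuous and let $\varphi\colon X\to\mathbb{R}$ be uniformly continuous. Let $Z\subset X$ be an arbitrary subset. Then $$\underline{P}(Z,T,\varphi)=\min_{A\subset\mathbb{N}}\ \sup_{x\in Z}\underline{P}^A(x,T,\varphi),\qquad \overline{P}(Z,T,\varphi)=\min_{A\subset\mathbb{N}}\ \sup_{x\in Z}\overline{P}^A(x,T,\varphi),$$ where the minima (which are attained) are over all oracles $A\subset\mathbb{N}$.
   Context: Conventions: $\log$ is base $2$; quantities take values in $[-\infty,\infty]$. Dynamics: $S_n\varphi=\sum_{k=0}^{n-1}\varphi\circ T^k$; the Bowen ball is $B_n(x,T,\varepsilon)=\{y\in X: d(T^ix,T^iy)<\varepsilon \text{ for } 0\le i<n\}$; $\varphi(x,n,\varepsilon)=\sup_{y\in B_n(x,T,\varepsilon)}S_n\varphi(y)$. Complexity: fix a universal prefix-free oracle machine $U$. For an oracle $A\subset\mathbb{N}$ and a finite binary string $\sigma$, $K^A(\sigma)=\min\{|\tau|: U^A(\tau)=\sigma\}$. Natural numbers (and tuples) are identified with strings through fixed computable codings, so $K^A(i)$ makes sense for $i\in\mathbb{N}$. Pointwise pressures: for $x\in X$, $\varepsilon>0$, $$\underline{P}^A(x,T,\varphi,\varepsilon)=\liminf_{n\to\infty}\min_{x_i\in B_n(x,T,\varepsilon)}\frac{K^A(i)+S_n\varphi(x_i)}{n},\qquad \underline{P}^A(x,T,\varphi)=\lim_{\varepsilon\to0}\underline{P}^A(x,T,\varphi,\varepsilon),$$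 and $\overline{P}^A(x,T,\varphi,\varepsilon)$, $\overline{P}^A(x,T,\varphi)$ are defined in the same way with $\limsup_{n\to\infty}$ in place of $\liminf_{n\to\infty}$. (The minimum is over indices $i$ with $x_i\in B_n(x,T,\varepsilon)$.) Lower (Pesin–Pitskel) pressure: let $\mathcal{P}(Z,N,\varepsilon)$ be the collection of countable families $\{(y_j,n_j)\}\subset X\times\{N,N+1,\dots\}$ with $Z\subset\bigcup_jB_{n_j}(y_j,T,\varepsilon)$. For $s\in\mathbb{R}$ put $m_P(Z,s,\varphi,N,\varepsilon)=\inf_{\mathcal{P}(Z,N,\varepsilon)}\sum_j2^{-n_js+\varphi(y_j,n_j,\varepsilon)}$ and $m_P(Z,s,\varphi,\varepsilon)=\lim_{N\to\infty}m_P(Z,s,\varphi,N,\varepsilon)$. Then $\underline{P}(Z,T,\varphi,\varepsilon)=\inf\{s\in\mathbb{R}: m_P(Z,s,\varphi,\varepsilon)=0\}$ and $\underline{P}(Z,T,\varphi)=\lim_{\varepsilon\to0}\underline{P}(Z,T,\varphi,\varepsilon)$. Upper (packing) pressure, in its modified upper capacity form: $N(Z,T,\varphi,n,\varepsilon)=\inf\{\sum_{x\in E}2^{\varphi(x,n,\varepsilon)}: E\subset X\text{ countable}, Z\subset\bigcup_{x\in E}B_n(x,T,\varepsilon)\}$; $P_{\mathrm{UC}}(Z,T,\varphi,\varepsilon)=\limsup_{n\to\infty}\frac1n\log N(Z,T,\varphi,n,\varepsilon)$; $P_{\mathrm{mUC}}(Z,T,\varphi,\varepsilon)=\inf\{\sup_{i}P_{\mathrm{UC}}(Z_i,T,\varphi,\varepsilon):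 Z\subset\bigcup_{i\in\mathbb{N}}Z_i\}$ (infimum over countable covers); and $\overline{P}(Z,T,\varphi)=\lim_{\varepsilon\to0}P_{\mathrm{mUC}}(Z,T,\varphi,\varepsilon)$. *)

(* Defs.v *)
From HB Require Import structures.
From mathcomp Require Import all_boot all_order all_algebra.
From mathcomp Require Import all_classical all_reals all_analysis.
From mathcomp Require Import zify.

Set Implicit Arguments.
Unset Strict Implicit.
Unset Printing Implicit Defensive.

Import Order.TTheory GRing.Theory Num.Theory.
Import numFieldTopology.Exports numFieldNormedType.Exports.

Local Open Scope classical_set_scope.

(* The partial recursive functionals: mu-recursive functions with a query
   operation for the characteristic function of the oracle.  Arities are not
   tracked by the type: a missing argument is read as 0 and extra arguments are
   ignored, which does not change the class of partial functions obtained. *)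
Inductive recfun : Type :=
| Zero
| Succ
| Proj of nat
| Query
| Comp of recfun & seq recfun
| PrimRec of recfun & recfun
| Mu of recfun.

(* [eval A c v y]: with oracle [A], [c] is defined on [v] with value [y]. *)
Fixpoint eval (A : set nat) (c : recfun) (v : seq nat) (y : nat) : Prop :=
  match c with
  | Zero => y = 0
  | Succ => y = (head 0 v).+1
  | Proj k => y = nth 0 v k
  | Query => y = (head 0 v \in A)
  | Comp f gs =>
      exists2 ws : seq nat,
        (fix evals gs ws := match gs, ws with
           | [::], [::] => True
           | g :: gs', w :: ws' => eval A g v w /\ evals gs' ws'
           | _, _ => False
           end) gs ws
        & eval A f ws y
  | PrimRec f g =>
      (fix rec n z := match n with
         | 0 => eval A f (behead v) z
         | m.+1 => exists2 u, rec m u & eval A g (u :: m :: behead v) z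
         end) (head 0 v) y
  | Mu f =>
      eval A f (y :: v) 0 /\
      forall m, m < y -> exists k, eval A f (m :: v) k.+1
  end.

Fixpoint eval_functional A c v y z {struct c} :
  eval A c v y -> eval A c v z -> y = z.
Proof.
case: c => [||k||f gs|f g|f] /=; try by move=> -> ->.
- move=> [ws ews fy] [ws' ews' fz].
  suff ww : ws = ws' by subst ws'; exact: eval_functional fy fz.
  move: gs ws ws' ews ews' {fy fz}.
  refine (fix IH (gs : seq recfun) := _).
  case: gs => [|g gs] [|w ws] [|w' ws'] // [gw gws] [gw' gws'].
  by rewrite (eval_functional _ _ _ _ _ gw gw') (IH gs _ _ gws gws').
- elim: (head 0 v) y z => [|m IHm] y z; first exact: eval_functional.
  move=> [u ru gy] [u' ru' gz]; move: gy; rewrite (IHm _ _ ru ru') => gy.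
  exact: eval_functional gy gz.
- move=> [fy0 fy] [fz0 fz]; case: (ltngtP y z) => // lt.
  + by have [k fk] := fz _ lt; have := eval_functional _ _ _ _ _ fy0 fk.
  + by have [k fk] := fy _ lt; have := eval_functional _ _ _ _ _ fz0 fk.
Qed.

(* Length-lexicographic coding of binary strings: [s] is the string obtained
   by removing the leading 1 from the binary expansion of
   [(nat_of_bits s).+1]. *)
Definition nat_of_bits (s : seq bool) : nat :=
  foldl (fun n (b : bool) => n.*2 + b.+1) 0 s.

(* Successor in that order, on strings read from the last bit. *)
Fixpoint incr_rev (s : seq bool) : seq bool :=
  match s with
  | [::] => [:: false]
  | false :: s' => true :: s'
  | true :: s' => false :: incr_rev s'
  end.

Definition bits_of_nat (n : nat) : seq bool := rev (iter n incr_rev [::]).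

Lemma bits_of_natK : cancel bits_of_nat nat_of_bits.
Proof.
move=> n; rewrite /nat_of_bits /bits_of_nat foldl_rev.
have incrE s : foldr (fun (b : bool) k => k.*2 + b.+1) 0 (incr_rev s) =
    (foldr (fun (b : bool) k => k.*2 + b.+1) 0 s).+1.
  by elim: s => [//|[] s /= IHs] //=; [rewrite IHs|]; lia.
by elim: n => //= n IHn; rewrite incrE IHn.
Qed.

Lemma nat_of_bits_inj : injective nat_of_bits.
Proof.
move=> s t; rewrite -[s]revK -[t]revK /nat_of_bits !foldl_rev => st.
congr rev; move: (rev s) (rev t) st => {}s {}t.
elim: s t => [|b s IHs] [|c t] //=; [lia|lia|move=> st].
have bc : b = c by case: b c st => -[] //=; lia.
by rewrite bc (IHs t) //; move: st; rewrite bc; lia.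
Qed.

Lemma nat_of_bitsK : cancel nat_of_bits bits_of_nat.
Proof. by move=> s; apply: nat_of_bits_inj; rewrite bits_of_natK. Qed.

Definition run (M : recfun) (A : set nat) (p s : seq bool) : Prop :=
  eval A M [:: nat_of_bits p] (nat_of_bits s).

Definition prefix_free_machine (M : recfun) : Prop :=
  forall (A : set nat) (p q s t : seq bool),
    run M A p s -> run M A q t -> prefix p q -> p = q.

Definition universal_machine (U : recfun) : Prop :=
  prefix_free_machine U /\
  forall M : recfun, prefix_free_machine M ->
    exists r : seq bool, forall (A : set nat) (p s : seq bool),
      run U A (r ++ p) s <-> run M A p s.

HB.structure Definition CompleteMetric (R : numDomainType) :=
  {X of Metric R X & Complete X}.
Notation completeMetricType := CompleteMetric.type.

Section pressure.
Local Open Scope ring_scope.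
Local Open Scope ereal_scope.

Definition kolmogorov (R : realType) (U : recfun) (A : set nat)
    (s : seq bool) : \bar R :=
  ereal_inf [set (size p)%:R%:E | p in [set p | run U A p s]].

Definition kolmogorov_nat (R : realType) (U : recfun) (A : set nat)
    (i : nat) : \bar R :=
  kolmogorov R U A (bits_of_nat i).

Definition exp2e (R : realType) (a : \bar R) : \bar R :=
  expeR (a * (ln 2)%:E).

Definition log2e (R : realType) (a : \bar R) : \bar R :=
  lne a * ((ln 2)^-1)%:E.

Context {R : realType} {X : completeMetricType R}.
Implicit Types (T : X -> X) (phi : X -> R) (Z : set X) (e : R) (n N : nat).

Definition birkhoff_sum T phi n (y : X) : R :=
  (\sum_(0 <= k < n) phi (iter k T y))%R.

Definition bowen_ball n (y : X) T e : set X :=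
  [set z | forall i, (i < n)%N -> (mdist (iter i T y) (iter i T z) < e)%R].

Definition sup_sum T phi (y : X) n e : \bar R :=
  ereal_sup [set (birkhoff_sum T phi n z)%:E | z in bowen_ball n y T e].

(* The minimum over [i] is written as an infimum in the extended reals: for
   large [e] and unbounded [phi] it need not be attained. *)
Definition point_rate U (A : set nat) (xs : nat -> X) (x : X) T phi e n
    : \bar R :=
  ereal_inf [set (kolmogorov_nat R U A i + (birkhoff_sum T phi n (xs i))%:E)
                 * (n%:R^-1)%:E
            | i in [set i | bowen_ball n x T e (xs i)]].

Definition lower_point_pressure_at U A xs x T phi e : \bar R :=
  limn_einf (point_rate U A xs x T phi e).

Definition upper_point_pressure_at U A xs x T phi e : \bar R :=
  limn_esup (point_rate U A xs x T phi e).

(* [lim] has a junk value when the limit does not exist.  The limits at 0 of the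
   pointwise pressures exist by monotonicity in [e]; those of
   [lower_pressure_at] and [P_mUC], which are not monotone in [e] because of
   [sup_sum], exist when [phi] is uniformly continuous. *)
Definition lower_point_pressure U A xs x T phi : \bar R :=
  lim (lower_point_pressure_at U A xs x T phi e @[e --> (0:R)^'+]).

Definition upper_point_pressure U A xs x T phi : \bar R :=
  lim (upper_point_pressure_at U A xs x T phi e @[e --> (0:R)^'+]).

Definition bowen_covers Z T N e : set (set (X * nat)) :=
  [set C | [/\ countable C, (forall c, C c -> (N <= c.2)%N)
             & Z `<=` \bigcup_(c in C) bowen_ball c.2 c.1 T e]].

Definition mP_level Z (s : R) T phi N e : \bar R :=
  ereal_inf [set \esum_(c in C)
                   exp2e ((- (c.2%:R * s))%:E + sup_sum T phi c.1 c.2 e)%E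
            | C in bowen_covers Z T N e].

Definition mP Z (s : R) T phi e : \bar R :=
  limn (fun N => mP_level Z s T phi N e).

Definition lower_pressure_at Z T phi e : \bar R :=
  ereal_inf [set s%:E | s in [set s : R | mP Z s T phi e = 0]].

Definition lower_pressure Z T phi : \bar R :=
  lim (lower_pressure_at Z T phi e @[e --> (0:R)^'+]).

Definition spanning_sum Z T phi n e : \bar R :=
  ereal_inf [set \esum_(y in E) exp2e (sup_sum T phi y n e)
            | E in [set E : set X | countable E /\
                      Z `<=` \bigcup_(y in E) bowen_ball n y T e]].

Definition P_UC Z T phi e : \bar R :=
  limn_esup (fun n => (n%:R^-1)%:E * log2e (spanning_sum Z T phi n e)).

Definition P_mUC Z T phi e : \bar R :=
  ereal_inf [set ereal_sup (range (fun i => P_UC (Zs i) T phi e))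
            | Zs in [set Zs : nat -> set X | Z `<=` \bigcup_i Zs i]].

Definition upper_pressure Z T phi : \bar R :=
  lim (P_mUC Z T phi e @[e --> (0:R)^'+]).

End pressure.

Definition is_minimum (R : realType) (S : set (\bar R)) (m : \bar R) : Prop :=
  S m /\ lbound S m.

(* Main.v *)
Require Import Defs.
From mathcomp Require Import all_boot all_order all_algebra.
From mathcomp Require Import all_classical all_reals all_analysis.
From mathcomp Require Import finmap zify ring lra.

Import Order.TTheory GRing.Theory Num.Theory.
Import numFieldTopology.Exports numFieldNormedType.Exports.
Local Open Scope classical_set_scope.

(** Both equalities say that a cover of Z by Bowen balls and a description of
the points of Z by programs can be traded for each other, a ball around y at
time n being worth about n s - S_n phi(y) bits.

From descriptions to covers (for every oracle). If the pointwise pressure of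
all x in Z is below s, then x is seen at time n (for infinitely many n, or for
all large n) from a point x_i of cost K(i) + S_n phi(x_i) < n s. By the Kraft
inequality the weights 2^(S_n phi(x_i)) of these cheap points add up to at most
2^(n s) ([cheap_points_weight_le]), and the balls around them cover Z. Uniform
continuity of phi gives sup_sum <= S_n phi + n d once the radius is small, and
any s + d < t absorbs the loss ([lower_pressure_at_le], [P_mUC_le]).

From covers to descriptions (for one well chosen oracle). If the pressure of Z
at radius e_j is below s_j for all j, there are countable families of balls
whose weights 2^(sup_sum - n s) have a sum as small as one likes, hence at most
1/2 for all of them together. The converse of the Kraft inequality
([prefix_code_exists]) gives the balls codewords of length about n s - sup_sum
that form a prefix-free set. The cover may well be uncomputable, so it goes
into the oracle, which is the table that sends the codeword of a ball to the
index of a dense point in this ball; a single machine reads tables. It must be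
prefix-free for all oracles, not only for well-formed tables, so it accepts a
codeword only after checking that no proper prefix is in the table
([table_machine_prefix_free]). Universality of U costs a constant, which
vanishes after division by n ([oracle_for_covers]).

The limit in the radius. The pointwise pressures are monotone in the radius e,
but the pressures F(e) of Z are not, because of sup_sum. Choose e_j -> 0 along
which F realises its liminf L, and an oracle for this sequence: its pointwise
pressures are at most L, by the second part. By the first part applied to the
same oracle, limsup F <= L. So F converges to L, the oracle attains L, and the
first part shows that no oracle does better ([is_minimum_lim]). *)

Set Implicit Arguments.
Unset Strict Implicit.
Unset Printing Implicit Defensive.

Local Notation eval := Defs.eval.

(** * Binary strings as numbers *)

(** [(nat_of_bits s).+1] has binary expansion 1 followed by s; this is why the
next lemmas, and the keys of the table below, use the successor. *)
Lemma nat_of_bits_rcons s (b : bool) :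
  (nat_of_bits (rcons s b)).+1 = (nat_of_bits s).+1.*2 + b.
Proof. by rewrite /nat_of_bits foldl_rcons; lia. Qed.

Lemma nat_of_bits_cat s u : exists2 a, a < 2 ^ size u &
  (nat_of_bits (s ++ u)).+1 = (nat_of_bits s).+1 * 2 ^ size u + a.
Proof.
elim/last_ind: u => [|u b [a lta eqa]].
  by exists 0; rewrite ?cats0 ?muln1 ?addn0.
exists (a.*2 + b); rewrite size_rcons expnS; first by lia.
by rewrite -rcons_cat nat_of_bits_rcons eqa; lia.
Qed.

Lemma size_bits_of_nat l a : a < 2 ^ l ->
  size (bits_of_nat (2 ^ l + a).-1) = l.
Proof.
move=> lt_a; set s := bits_of_nat _.
have Es : (nat_of_bits s).+1 = 2 ^ l + a.
  by rewrite bits_of_natK prednK // addn_gt0 expn_gt0.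
clearbody s; have [a' lta'] := nat_of_bits_cat [::] s.
rewrite cat0s mul1n Es => eq_a.
case: (ltngtP (size s) l) => // lt.
  have : 2 ^ (size s).+1 <= 2 ^ l by rewrite leq_exp2l.
  by rewrite expnS; lia.
have : 2 ^ l.+1 <= 2 ^ size s by rewrite leq_exp2l.
by rewrite expnS; lia.
Qed.

Lemma iter_half_nat_of_bits s u :
  iter (size u) half (nat_of_bits (s ++ u)).+1 = (nat_of_bits s).+1.
Proof.
elim/last_ind: u => [|u b IHu]; first by rewrite cats0.
rewrite size_rcons iterSr -rcons_cat nat_of_bits_rcons addnC.
by rewrite half_bit_double.
Qed.

Lemma iter_half_prefix t s s' :
  iter t half (nat_of_bits s).+1 = (nat_of_bits s').+1 ->
  prefix s' s /\ size s = size s' + t.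
Proof.
have [le_ts|lt_st] := leqP t (size s).
  have st : size (drop (size s - t) s) = t by rewrite size_drop subKn.
  have := iter_half_nat_of_bits (take (size s - t) s) (drop (size s - t) s).
  rewrite cat_take_drop st => ->.
  case=> /nat_of_bits_inj <-; split; first exact: prefix_take.
  by rewrite -{1}(cat_take_drop (size s - t) s) size_cat st.
rewrite -(subnK lt_st) addnS -addSn iterD iterSr.
have := iter_half_nat_of_bits [::] s; rewrite cat0s => -> /=.
by have -> : forall k, iter k half 0 = 0 by elim=> // k IHk; rewrite iterS IHk.
Qed.

(** * A prefix-free machine that reads a table from its oracle *)

(** The next three lemmas evaluate a program without unfolding [eval]. *)
Lemma eval_comp1 A f g v x y :
  eval A g v x -> eval A f [:: x] y -> eval A (Comp f [:: g]) v y.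
Proof. by move=> gx fy; exists [:: x]. Qed.

Lemma eval_comp2 A f g h v x y z :
  eval A g v x -> eval A h v y -> eval A f [:: x; y] z ->
  eval A (Comp f [:: g; h]) v z.
Proof. by move=> gx hy fz; exists [:: x; y]. Qed.

Lemma eval_primrec A f g w (r : nat -> nat) :
  eval A f w (r 0) -> (forall m, eval A g [:: r m, m & w] (r m.+1)) ->
  forall n, eval A (PrimRec f g) (n :: w) (r n).
Proof. by move=> f0 gS; elim=> [//|n IHn]; exists (r n). Qed.

Definition rec_add := PrimRec (Proj 0) (Comp Succ [:: Proj 0]).
Definition rec_pred := PrimRec Zero (Proj 1).
(** The operands of the subtraction are reversed, since recursion is on the
first argument. *)
Definition rec_subr := PrimRec (Proj 0) (Comp rec_pred [:: Proj 0]).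
Definition rec_not c := Comp rec_subr [:: c; Comp Succ [:: Zero]].
(** The recursion is half (m + 1) = m - half m. *)
Definition rec_half := PrimRec Zero (Comp rec_subr [:: Proj 0; Proj 1]).
(** Halving [(nat_of_bits s).+1] removes the last bit of s: iterated halves are
the ancestors of s in the binary tree. *)
Definition rec_anc := PrimRec (Proj 0) (Comp rec_half [:: Proj 0]).
Definition rec_pair :=
  PrimRec (Comp Succ [:: Comp rec_add [:: Proj 0; Proj 0]])
          (Comp rec_add [:: Proj 0; Proj 0]).

Lemma eval_add A x y : eval A rec_add [:: x; y] (x + y).
Proof.
apply: (@eval_primrec _ _ _ _ (addn^~ y)) => // m.
by apply: eval_comp1; rewrite /=.
Qed.

Lemma eval_pred A x : eval A rec_pred [:: x] x.-1.
Proof. exact: (@eval_primrec _ _ _ _ predn). Qed.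

Lemma eval_subr A x y : eval A rec_subr [:: x; y] (y - x).
Proof.
apply: (@eval_primrec _ _ _ _ (subn y)) => [|m]; first by rewrite subn0.
by rewrite subnS; apply: eval_comp1; [|exact: eval_pred].
Qed.

Lemma eval_not A c v (b : bool) :
  eval A c v b -> eval A (rec_not c) v (~~ b).
Proof.
move=> cb; have -> : (~~ b : nat) = 1 - b by case: b {cb}.
apply: eval_comp2 cb _ (eval_subr _ _ 1).
exact: (@eval_comp1 _ Succ Zero _ 0).
Qed.

Lemma eval_half A x : eval A rec_half [:: x] x./2.
Proof.
apply: (@eval_primrec _ _ _ _ half) => // m.
have -> : m.+1./2 = m - m./2 by lia.
by apply: eval_comp2; [| |exact: eval_subr].
Qed.

Lemma eval_anc A t x : eval A rec_anc [:: t; x] (iter t half x).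
Proof.
apply: (@eval_primrec _ _ _ _ (fun t => iter t half x)) => // m.
by apply: eval_comp1; [|exact: eval_half].
Qed.

(** The table holds the pairs (a, 0) for the keys a, and (a, y.+1) if y is a
value of a; the key of the string s is [(nat_of_bits s).+1]. *)
Definition code_pair a y := 2 ^ a * y.*2.+1.

Lemma eval_pair A a y : eval A rec_pair [:: a; y] (code_pair a y).
Proof.
have dbl w z : eval A (Comp rec_add [:: Proj 0; Proj 0]) (z :: w) (z + z).
  by apply: (@eval_comp2 _ _ _ _ _ z z) => //; exact: eval_add.
apply: (@eval_primrec _ _ _ _ (code_pair^~ y)) => [|m].
  rewrite /code_pair mul1n -addnn.
  by apply: (@eval_comp1 _ _ _ _ (y + y)); first exact: dbl.
rewrite [code_pair m.+1 y](_ : _ = code_pair m y + code_pair m y).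
  exact: dbl.
by rewrite /code_pair expnS -mulnA mul2n addnn.
Qed.

Lemma code_pair_inj a b x y :
  code_pair a x = code_pair b y -> a = b /\ x = y.
Proof.
rewrite /code_pair; elim: a b => [|a IHa] [|b]; rewrite ?expn0 ?expnS ?mul1n.
- by lia.
- by rewrite -mulnA; lia.
- by rewrite -mulnA; lia.
- by rewrite -!mulnA => /eqP; rewrite eqn_mul2l /= => /eqP/IHa[-> ->].
Qed.

Definition rec_is_key := Comp Query [:: Comp rec_pair [:: Proj 0; Zero]].

Lemma eval_is_key A x : eval A rec_is_key [:: x] (code_pair x 0 \in A).
Proof.
by apply: eval_comp1 => //; apply: eval_comp2; [| |exact: eval_pair].
Qed.

(** A count over the first t proper ancestors; t is later taken so large that
all of them are inspected. *)
Definition rec_keys_above :=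
  PrimRec Zero (Comp rec_add
    [:: Proj 0;
        Comp rec_is_key [:: Comp rec_anc [:: Comp Succ [:: Proj 1]; Proj 2]]]).

Lemma eval_keys_above A t x : eval A rec_keys_above [:: t; x]
  (\sum_(0 <= j < t) (code_pair (iter j.+1 half x) 0 \in A)).
Proof.
pose r t := \sum_(0 <= j < t) (code_pair (iter j.+1 half x) 0 \in A).
apply: (@eval_primrec _ _ _ _ r) => [|m]; first by rewrite /r big_geq.
rewrite [r m.+1]big_nat_recr // -/(r m).
apply: (@eval_comp2 _ _ _ _ _ (r m)) (eval_add _ _ _) => //.
apply: eval_comp1 (eval_is_key _ _).
apply: (@eval_comp2 _ _ _ _ _ m.+1 x) (eval_anc _ _ _) => //.
by apply: (@eval_comp1 _ _ _ _ m).
Qed.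

(** Vanishes at (y, m) if and only if the string m is a key, none of its proper
prefixes is one, and y is a value of m. Being total, it can be minimised over
y. *)
Definition rec_test :=
  let x := Comp Succ [:: Proj 1] in
  Comp rec_add
    [:: Comp rec_keys_above [:: x; x];
        Comp rec_add
          [:: rec_not (Comp rec_is_key [:: x]);
              rec_not (Comp Query
                [:: Comp rec_pair [:: x; Comp Succ [:: Proj 0]]])]].

Definition test_value (A : set nat) (y m : nat) : nat :=
  \sum_(0 <= j < m.+1) (code_pair (iter j.+1 half m.+1) 0 \in A)
  + ((code_pair m.+1 0 \notin A) + (code_pair m.+1 y.+1 \notin A)).

Lemma eval_test A y m : eval A rec_test [:: y; m] (test_value A y m).
Proof.
have x_m : eval A (Comp Succ [:: Proj 1]) [:: y; m] m.+1.
  by apply: (@eval_comp1 _ _ _ _ m).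
have y_y : eval A (Comp Succ [:: Proj 0]) [:: y; m] y.+1.
  by apply: (@eval_comp1 _ _ _ _ y).
apply: eval_comp2 (eval_add _ _ _).
  by apply: eval_comp2 (eval_keys_above _ _ _); exact: x_m.
apply: eval_comp2 (eval_add _ _ _).
  by apply: eval_not; apply: eval_comp1 (eval_is_key _ _); exact: x_m.
apply: eval_not; apply: (@eval_comp1 _ _ _ _ (code_pair m.+1 y.+1)) => //.
by apply: eval_comp2 (eval_pair _ _ _); [exact: x_m|exact: y_y].
Qed.

Definition table_machine := Mu rec_test.

Lemma eval_table_machine A m y : eval A table_machine [:: m] y <->
  test_value A y m = 0 /\ forall y', y' < y -> test_value A y' m != 0.
Proof.
split=> [[t0 tS]|[t0 tS]]; split.
- exact: eval_functional (eval_test A y m) t0.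
- move=> y' /tS[k tk]; rewrite (eval_functional (eval_test A y' m) tk).
  by [].
- by rewrite -t0; exact: eval_test.
- move=> y' /tS; have := eval_test A y' m.
  by case: (test_value A y' m) => // k tk _; exists k.
Qed.

Lemma test_value_eq0 A y m : test_value A y m = 0 <->
  [/\ forall j, j <= m -> ~ A (code_pair (iter j.+1 half m.+1) 0),
      A (code_pair m.+1 0) & A (code_pair m.+1 y.+1)].
Proof.
rewrite /test_value; split.
  move=> /eqP; rewrite !addn_eq0 !eqb0 !negbK => /and3P[].
  rewrite big_mkord sum_nat_eq0 => /forallP/= g /set_mem d /set_mem q.
  split=> // j jm Aj.
  have jm1 : j < m.+1 by [].
  have := g (Ordinal jm1).
  by rewrite eqb0 => /negP; apply; exact/mem_set.
move=> [g d q]; rewrite !mem_set //= big_nat big1 // => j jm.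
by rewrite memNset //; exact: g.
Qed.

(** Prefix-freeness holds for arbitrary oracles, because two comparable strings
cannot both be minimal keys. *)
Lemma table_machine_prefix_free : prefix_free_machine table_machine.
Proof.
move=> A p q s t /eval_table_machine[/test_value_eq0[_ Dp _] _].
move=> /eval_table_machine[/test_value_eq0[gq _ _] _] /prefixP[u qE].
case: u => [|b u] in qE; first by rewrite qE cats0.
(* p is the ancestor of q reached after [size u].+1 halvings. *)
have := gq (size u); rewrite qE.
rewrite (_ : (size u).+1 = size (b :: u)) // iter_half_nat_of_bits => ndp.
exfalso; apply: ndp Dp.
(* What remains is that the test goes that far up: [size u <= nat_of_bits q]. *)
have [a _] := nat_of_bits_cat p (b :: u).
move=> eq_a; rewrite -ltnS eq_a.
apply: leq_trans (leq_addr _ _); rewrite mulSn.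
by rewrite (leq_trans (ltnW (ltn_expl _ (ltnSn 1)))) // leq_addr.
Qed.

Definition table_oracle (W : Type) (D : set W) (p : W -> seq bool)
    (v : W -> nat) : set nat :=
  [set code_pair (nat_of_bits (p w)).+1 0 | w in D] `|`
  [set code_pair (nat_of_bits (p w)).+1 (v w).+1 | w in D].

(** On the table of a prefix-free code, the test never rejects a codeword. *)
Lemma run_table_machine (W : Type) (D : set W) (p : W -> seq bool)
    (v : W -> nat) :
  {in D &, forall w w', prefix (p w) (p w') -> w = w'} ->
  {in D, forall w,
    run table_machine (table_oracle D p v) (p w) (bits_of_nat (v w))}.
Proof.
move=> pf w Dw; rewrite /run bits_of_natK; apply/eval_table_machine.
have DE a : table_oracle D p v (code_pair a 0) ->
    exists2 w', D w' & a = (nat_of_bits (p w')).+1.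
  by case=> -[w' Dw' /code_pair_inj[<- //]]; exists w'.
have VE a y : table_oracle D p v (code_pair a y.+1) ->
    exists2 w', D w' & a = (nat_of_bits (p w')).+1 /\ y = v w'.
  by case=> -[w' Dw' /code_pair_inj[<- //]] [<-]; exists w'.
have inD w' : D w' -> w' \in D by move/mem_set.
split; [apply/test_value_eq0; split|].
- move=> j _ /DE[w' Dw'].
  move=> /iter_half_prefix[pp sz]; move: (pf w' w (inD _ Dw') Dw pp) sz => ->.
  by lia.
- left; by exists w => //; exact/set_mem.
- right; by exists w => //; exact/set_mem.
- move=> y' lt_y'; apply/eqP => /test_value_eq0[_ _ /VE[w' Dw' [[pp] yv]]].
  have ww : w = w'.
    apply: (pf w w' Dw (inD _ Dw')).
    by rewrite (nat_of_bits_inj pp) prefix_refl.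
  by move: lt_y'; rewrite yv ww ltnn.
Qed.

(** * The Kraft inequality and its converse *)

Section kraft.
Local Open Scope ring_scope.
Variable R : realType.

(** Induction on the maximal length: unless the empty string is present, and
then alone, the strings split according to the first bit, and removing this bit
doubles the weight of each half. *)
Lemma kraft_inequality_seq (ps : seq (seq bool)) : uniq ps ->
  {in ps &, forall p q, prefix p q -> p = q} ->
  \sum_(p <- ps) 2 ^- size p <= 1 :> R.
Proof.
have ps1 (qs : seq (seq bool)) : uniq qs ->
    {in qs &, forall p q, prefix p q -> p = q} ->
    [::] \in qs -> qs = [:: [::]].
  move=> uqs pfq e_in; apply/perm_small_eq => //; apply: uniq_perm => // q.
  rewrite inE; apply/idP/eqP => [qin|->//].
  by apply/esym/pfq => //; rewrite prefix0s.
have [L leL] : exists L, all (fun p => (size p <= L)%N) ps.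
  exists (\max_(p <- ps) size p)%N; apply/allP => p pin.
  by rewrite (leq_bigmax_seq _ pin).
elim: L ps leL => [|L IHL] ps leL ups pf;
    have [e_in|e_nin] := boolP ([::] \in ps).
- by rewrite (ps1 ps ups pf e_in) big_seq1 expr0 invr1.
- have -> : ps = [::]; last by rewrite big_nil.
  move: leL e_nin; clear; case: ps => [//|[|b q] ps] //.
- by rewrite (ps1 ps ups pf e_in) big_seq1 expr0 invr1.
pose tl b := [seq behead p | p <- ps & head false p == b].
have hE p b : p \in ps -> head false p == b -> p = b :: behead p.
  by case: p => [|c p]; rewrite ?(negPf e_nin) //= => _ /eqP->.
have tl1 b : \sum_(p <- tl b) 2 ^- size p <= 1 :> R.
  apply: IHL.
  - apply/allP => _ /mapP[p + ->]; rewrite mem_filter => /andP[pb pin].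
    by have := allP leL _ pin; rewrite {1}(hE _ _ pin pb).
  - rewrite map_inj_in_uniq ?filter_uniq // => p q.
    rewrite !mem_filter => /andP[pb pin] /andP[qb qin] pq.
    by rewrite (hE _ _ pin pb) pq -(hE _ _ qin qb).
  - move=> _ _ /mapP[p + ->] /mapP[q + ->].
    rewrite !mem_filter => /andP[pb pin] /andP[qb qin] pq.
    congr behead; apply: pf => //.
    by rewrite (hE _ _ pin pb) (hE _ _ qin qb) /= eqxx.
have tlE b : \sum_(p <- ps | head false p == b) 2 ^- size p =
    2^-1 * \sum_(p <- tl b) 2 ^- size p :> R.
  rewrite big_map big_filter big_distrr big_seq_cond [RHS]big_seq_cond /=.
  apply: eq_bigr => p /andP[pin pb].
  by rewrite {1}(hE _ _ pin pb) /= exprS invfM.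
rewrite (bigID (fun p => head false p == true)) /=.
under [X in _ + X]eq_bigl do rewrite eqb_id -eqbF_neg.
rewrite !tlE; have := tl1 true; have := tl1 false; lra.
Qed.

Lemma kraft_inequality (W : choiceType) (D : set W) (p : W -> seq bool) :
  {in D &, forall w w', prefix (p w) (p w') -> w = w'} ->
  (\esum_(w in D) (2 ^- size (p w) : R)%:E <= 1)%E.
Proof.
move=> pf; apply: ge_ereal_sup => _ [F [finF FD] <-].
rewrite fsbig_finite //= sumEFin lee_fin.
rewrite -(big_map p xpredT (fun q => 2 ^- size q)).
have inD (w : W) : w \in fset_set F -> w \in D.
  by rewrite in_fset_set // => /set_mem Fw; apply/mem_set/FD.
apply: kraft_inequality_seq.
  rewrite map_inj_in_uniq ?fset_uniq // => w w' /inD wD /inD w'D pp.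
  by apply: pf => //; rewrite pp prefix_refl.
move=> _ _ /mapP[w /inD wD ->] /mapP[w' /inD w'D ->] /pf -> //.
Qed.

Lemma subset_esum (W : choiceType) (A B : set W) (a : W -> \bar R) :
  A `<=` B -> (\esum_(w in A) a w <= \esum_(w in B) a w)%E.
Proof.
move=> AB; apply: ereal_sup_le => _ [F [finF FA] <-]; exists F => //.
by split=> //; exact: subset_trans AB.
Qed.

(** Lay out consecutive intervals of length 2 * 2^-(l w) in [0, 1]; the total
weight 1/2 makes them fit. An interval of twice the length contains a dyadic
interval of length 2^-(l w), and dyadic intervals are the cylinders of binary
strings, disjoint if and only if the strings are not comparable. Doubling the
intervals makes this work in whatever order the lengths come. *)
Lemma prefix_code_exists (W : choiceType) (D : set W) (l : W -> nat) :
  countable D ->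
  (\esum_(w in D) (2 ^- l w : R)%:E <= (2^-1)%:E)%E ->
  exists p : W -> seq bool, (forall w, D w -> size (p w) = l w) /\
    {in D &, forall w w', prefix (p w) (p w') -> w = w'}.
Proof.
move=> /countable_injP[g g_inj] le_half.
pose h w : R := 2 ^- l w.
have h0 w : 0 < h w by rewrite invr_gt0 exprn_gt0.
have hE0 w : (0 <= (h w)%:E)%E by rewrite lee_fin ltW.
pose below w := D `&` [set w' | (g w' < g w)%N].
have sumE S : S `<=` D -> (\esum_(w in S) (h w)%:E)%E \is a fin_num.
  move=> SD; rewrite ge0_fin_numE ?esum_ge0 //.
  by rewrite (le_lt_trans (subset_esum _ SD)) // (le_lt_trans le_half) // ltry.
pose c w := 2 * fine (\esum_(w' in below w) (h w')%:E)%E.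
have step S w : S `<=` D -> S w -> below w `<=` S ->
    c w + 2 * h w <= 2 * fine (\esum_(w in S) (h w)%:E)%E.
  move=> SD Sw bS; rewrite -mulrDr ler_pM2l // -lee_fin EFinD !fineK ?sumE //.
    rewrite (esumID [set w] S) // addeC setIidr; last by move=> _ ->.
    rewrite esum_set1 // leeD2l //; apply: subset_esum => w' bw'.
    by split; [exact: bS|move=> /= ww; case: bw' => _ /=; rewrite ww ltnn].
  by move=> w' [].
have c_mono w w' : D w -> D w' -> (g w < g w')%N -> c w + 2 * h w <= c w'.
  move=> Dw Dw' gg; apply: step; [by move=> ? []|by []|].
  by move=> w2 [Dw2 /= g2]; split=> //=; exact: ltn_trans gg.
have c_le1 w : D w -> c w + 2 * h w <= 1.
  move=> Dw; apply: le_trans (step D w _ _ _) _ => //; first by move=> ? [].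
  rewrite -ler_pdivlMl // mulr1 -lee_fin fineK ?sumE //.
have c0 w : 0 <= c w by rewrite mulr_ge0 // fine_ge0 // esum_ge0.
(* The dyadic interval is [a w, a w + 1] scaled by h w; rounding c w / h w up
   strictly costs at most one unit, and the interval has two. *)
pose a w := (Num.truncn (c w / h w)).+1.
have a_gt w : c w < (a w)%:R * h w.
  by rewrite -ltr_pdivrMr // truncnS_gt // divr_ge0 // ltW.
have a_le w : ((a w)%:R + 1) * h w <= c w + 2 * h w.
  have : (Num.truncn (c w / h w))%:R * h w <= c w.
    by rewrite -ler_pdivlMr // truncn_le // divr_ge0 // ltW.
  by rewrite /a -[in _.+1%:R]addn1 natrD; lra.
have hl w : h w * 2 ^+ l w = 1 by rewrite mulVf // expf_neq0.
have a_lt w : D w -> (a w < 2 ^ l w)%N.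
  move=> Dw; rewrite -(ltr_nat R) natrX.
  have := le_trans (a_le w) (c_le1 _ Dw).
  rewrite -(ltr_pM2r (h0 w)) [2 ^+ _ * _]mulrC hl; have := h0 w; lra.
(* The leading 1 encoded by [2 ^ l w] makes this the expansion of [a w] on
   exactly [l w] bits. *)
exists (fun w => bits_of_nat (2 ^ l w + a w).-1).
split=> [w Dw|w w' /set_mem Dw /set_mem Dw' /prefixP[u pu]].
  by rewrite size_bits_of_nat // a_lt.
have nE v : D v -> (nat_of_bits (bits_of_nat (2 ^ l v + a v).-1)).+1 =
   (2 ^ l v + a v)%N.
  by move=> Dv; rewrite bits_of_natK prednK // addn_gt0 expn_gt0.
have [b lt_b] := nat_of_bits_cat (bits_of_nat (2 ^ l w + a w).-1) u.
rewrite -pu !nE // => eq_b.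
have lE : l w' = (l w + size u)%N.
  have := congr1 size pu; rewrite size_cat !size_bits_of_nat ?a_lt //.
have aE : (a w' = a w * 2 ^ size u + b)%N.
  by move: eq_b; rewrite lE expnD mulnDl -addnA => /addnI.
have hE : h w' * 2 ^+ size u = h w.
  by rewrite /h lE exprD invfM mulfVK // expf_neq0.
(* If the codeword of w is a prefix of that of w', the left end of the dyadic
   interval of w' lies in the one of w, against the order of the layout. *)
have ge_a : (a w)%:R * h w <= (a w')%:R * h w'.
  have : 0 <= b%:R * h w' :> R by rewrite mulr_ge0 // ltW.
  by rewrite aE natrD natrM natrX -hE; lra.
have lt_a : (a w')%:R * h w' < ((a w)%:R + 1) * h w.
  have ltb : b%:R < 2 ^+ size u :> R by rewrite -natrX ltr_nat.
  have : b%:R * h w' < 2 ^+ size u * h w' by rewrite ltr_pM2r.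
  by rewrite aE natrD natrM natrX -hE; lra.
case: (ltngtP (g w) (g w')) => [gg|gg|]; last first.
- by apply: g_inj; exact/mem_set.
- exfalso; have := c_mono _ _ Dw' Dw gg; have := a_le w'; have := a_gt w.
  by have := h0 w'; lra.
- exfalso; have := c_mono _ _ Dw Dw' gg; have := a_le w; have := a_gt w'.
  by have := h0 w'; lra.
Qed.
End kraft.

(** * Limits in the extended reals *)

Section ereal_facts.
Local Open Scope ring_scope.
Local Open Scope ereal_scope.
Variable R : realType.
Implicit Types (x y : \bar R) (u : (\bar R)^nat).

Lemma ereal_lt_dense x y : x < y -> exists2 t : R, x < t%:E & t%:E < y.
Proof.
case: x y => [r| |] [r'| |] //=; rewrite ?lte_fin => lt_rr.
- by exists ((r + r') / 2)%R; rewrite lte_fin; lra.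
- by exists (r + 1)%R; rewrite ?ltry // lte_fin; lra.
- by exists (r' - 1)%R; rewrite ?ltNyr // lte_fin; lra.
- by exists 0%R; rewrite ?ltNyr ?ltry.
Qed.

Lemma ereal_le_real x y : (forall t : R, y < t%:E -> x <= t%:E) -> x <= y.
Proof.
move=> le_x; rewrite leNgt; apply/negP => /ereal_lt_dense[t /le_x].
by rewrite leNgt => /negP.
Qed.

Lemma limn_einf_lt u x : limn_einf u < x ->
  forall N, exists2 n, (N <= n)%N & u n < x.
Proof.
move=> lt_x N.
have : einfs u N < x.
  apply: le_lt_trans lt_x; rewrite limn_einf_lim.
  by rewrite (cvg_lim _ (@cvg_einfs_sup _ u)) // ereal_sup_ubound //; exists N.
by move=> /ereal_inf_lt[_ [n /= Nn <-] un]; exists n.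
Qed.

Lemma limn_einf_le u x :
  (forall N, exists2 n, (N <= n)%N & u n <= x) -> limn_einf u <= x.
Proof.
move=> ux; rewrite limn_einf_lim (cvg_lim _ (@cvg_einfs_sup _ u)) //.
apply: ge_ereal_sup => _ [N _ <-]; have [n Nn un] := ux N.
by apply: le_trans un; apply: ereal_inf_lbound; exists n.
Qed.

Lemma limn_esup_lt u x : limn_esup u < x ->
  exists N, forall n, (N <= n)%N -> u n < x.
Proof.
rewrite limn_esup_lim (cvg_lim _ (@cvg_esups_inf _ u)) //.
move=> /ereal_inf_lt[_ [N _ <-] uN]; exists N => n Nn.
by apply: le_lt_trans uN; apply: ereal_sup_ubound; exists n.
Qed.

Lemma limn_esup_le u x N :
  (forall n, (N <= n)%N -> u n <= x) -> limn_esup u <= x.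
Proof.
move=> ux; rewrite limn_esup_lim (cvg_lim _ (@cvg_esups_inf _ u)) //.
apply: le_trans (ereal_inf_lbound _) _; first by exists N.
by apply: ge_ereal_sup => _ [n /= Nn <-]; exact: ux.
Qed.

Lemma cvge_real_bounds (T : Type) (F : set_system T) {FF : Filter F}
    (f : T -> \bar R) (l : \bar R) :
  (forall t : R, t%:E < l -> \forall z \near F, t%:E <= f z) ->
  (forall t : R, l < t%:E -> \forall z \near F, f z <= t%:E) ->
  f z @[z --> F] --> l.
Proof.
case: l => [r| |] lo hi.
- have near_r d : (0 < d)%R ->
      \forall z \near F, (r - d)%:E <= f z <= (r + d)%:E.
    move=> d0; near do (apply/andP; split).
      by apply: lo; rewrite lte_fin; lra.
    by apply: hi; rewrite lte_fin; lra.
  apply/fine_cvgP; split.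
    apply: filterS (near_r _ ltr01) => z /andP[lo1 hi1].
    by rewrite fin_numElt (lt_le_trans _ lo1) ?ltNyr // (le_lt_trans hi1) ?ltry.
  apply/cvgrPdist_le => d d0; apply: filterS (near_r _ d0) => z /=.
  case: (f z) => [s| |] //=; rewrite ?leNye ?leye_eq ?andbF // !lee_fin.
  by move=> /andP[? ?]; rewrite ler_norml; apply/andP; split; lra.
- by apply/cvgeyPge => t; apply: lo; rewrite ltry.
- by apply/cvgeNyPle => t; apply: hi; rewrite ltNyr.
Unshelve. all: by end_near. Qed.

Lemma nat_invr_lt (t : R) : (0 < t)%R ->
  exists J, forall j, (J <= j)%N -> (j.+1%:R^-1 < t)%R.
Proof.
move=> t0; exists (Num.truncn t^-1) => j Jj.
rewrite invf_plt ?posrE //; apply: lt_le_trans (truncnS_gt _) _.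
by rewrite ler_nat ltnS.
Qed.

Lemma real_seq_above x : x < +oo ->
  exists2 s : nat -> R, (forall j, x < (s j)%:E) &
    forall t : R, x < t%:E -> exists J, forall j, (J <= j)%N -> (s j <= t)%R.
Proof.
case: x => [r _| //|_].
  exists (fun j => r + j.+1%:R^-1)%R => [j|t].
    by rewrite lte_fin ltrDl invr_gt0.
  rewrite lte_fin -subr_gt0 => /nat_invr_lt[J Jt]; exists J => j /Jt.
  by rewrite ltrBrDl => /ltW.
exists (fun j => - j%:R)%R => [j|t _]; first exact: ltNyr.
exists (Num.truncn (- t)).+1 => j Jj; rewrite lerNl.
by apply/ltW/(lt_le_trans (truncnS_gt _)); rewrite ler_nat.
Qed.

(** F e plays the pressure of Z at radius e, and P i x e the pointwise pressure
at x relative to the oracle i. Since F need not be monotone, the convergence of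
F is part of what is shown: the index i obtained for a sequence of radii that
realises the lower limit of F also bounds its upper limit. The factor 2 on the
radius is the price of describing x by another point of the same Bowen ball. *)
Lemma is_minimum_lim (I X : Type) (i0 : I) (Z : set X) (F : R -> \bar R)
    (P : I -> X -> R -> \bar R) :
  (forall i (x : X) (e e' : R), (0 < e <= e')%R -> P i x e' <= P i x e) ->
  (forall s e : nat -> R,
     (forall j, (0 < e j)%R) -> (forall j, F (e j) < (s j)%:E) ->
     exists i, forall x : X, Z x -> forall j, P i x (2 * e j)%R <= (s j)%:E) ->
  (forall i (s t : R), (s < t)%R ->
     (forall (x : X) (e : R), Z x -> (0 < e)%R -> P i x e < s%:E) ->
     \forall e \near (0 : R)^'+, F e <= t%:E) ->
  is_minimum
    [set ereal_sup [set lim (P i x e @[e --> (0 : R)^'+]) | x in Z]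
    | i in [set: I]]
    (lim (F e @[e --> (0 : R)^'+])).
Proof.
move=> P_mono upper lower.
pose S i := ereal_sup [set lim (P i x e @[e --> (0 : R)^'+]) | x in Z].
have limP i (x : X) : lim (P i x e @[e --> (0 : R)^'+]) =
    ereal_sup (P i x @` `]0%R, +oo[).
  apply: cvg_lim => //; apply: nonincreasing_at_right_cvge => //.
  move=> e e'; rewrite !in_itv /= !andbT => e0 e0' ee'.
  by apply: P_mono; rewrite e0.
have P_le_S i (x : X) (e : R) : Z x -> (0 < e)%R -> P i x e <= S i.
  move=> Zx e0; apply: (@le_trans _ _ (lim (P i x e @[e --> (0 : R)^'+]))).
    rewrite limP; apply: ereal_sup_ubound; exists e => //.
    by rewrite /= in_itv /= e0.
  by apply: ereal_sup_ubound; exists x.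
have S_lower i t : S i < t%:E -> \forall e \near (0 : R)^'+, F e <= t%:E.
  move=> /ereal_lt_dense[s Ss st]; apply: (lower i s t) => // x e Zx e0.
  exact: le_lt_trans (P_le_S _ _ _ Zx e0) Ss.
pose L := limf_einf F (0 : R)^'+.
have L_lower t : t%:E < L -> \forall e \near (0 : R)^'+, t%:E <= F e.
  rewrite /L limf_einfE => /ereal_sup_gt[_ [V V0 <-] tV].
  apply: filterS V0 => e Ve; apply: ltW; apply: lt_le_trans tV _.
  by apply: ereal_inf_lbound; exists e.
have L_le_S i : L <= S i.
  rewrite leNgt; apply/negP => /ereal_lt_dense[t St tL].
  have [t' St' t't] := ereal_lt_dense St.
  have : \forall e \near (0 : R)^'+, False.
    near=> e; have : t%:E <= F e by near: e; exact: L_lower.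
    have : F e <= t'%:E by near: e; exact: S_lower St'.
    by move=> Ft' tF; have := le_trans tF Ft'; rewrite leNgt t't.
  by move=> /filter_ex[].
have [i Si] : exists i, S i = L.
  suff [i le_i] : exists i, S i <= L.
    by exists i; apply/le_anti; rewrite le_i L_le_S.
  have [->|Ly] := eqVneq L +oo; first by exists i0; rewrite leey.
  have {Ly} : L < +oo by rewrite ltey.
  (* Radii [e j] -> 0 and levels [s j] -> L with F (e j) < s j. *)
  move=> /real_seq_above[s s_gt s_le].
  have /choice[e eP] j : exists e : R,
      (0 < e < j.+1%:R^-1)%R /\ F e < (s j)%:E.
    have V0 : (0 : R)^'+ `]0%R, (j.+1%:R^-1 : R)%R[%classic.
      rewrite /=; near=> e; rewrite /= in_itv /=; apply/andP; split; near: e.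
        exact: nbhs_right_gt.
      by apply: nbhs_right_lt; rewrite invr_gt0.
    have : ereal_inf (F @` `]0%R, (j.+1%:R^-1 : R)%R[) < (s j)%:E.
      apply: le_lt_trans (s_gt j); rewrite /L limf_einfE.
      by apply: ereal_sup_ubound; exists `]0%R, (j.+1%:R^-1 : R)%R[%classic.
    by move=> /ereal_inf_lt[_ [e /= + <-]]; rewrite in_itv /=; exists e.
  have [j|j|i le_i] := upper s e; [by case: (eP j) => /andP[]|by case: (eP j)|].
  exists i; apply: ge_ereal_sup => _ [x Zx <-]; rewrite limP.
  apply: ge_ereal_sup => _ [d /= + <-]; rewrite in_itv /= andbT => d0.
  apply: ereal_le_real => t /s_le[J Jt].
  have [J' Jd] : exists J', forall j, (J' <= j)%N -> (j.+1%:R^-1 < d / 2)%R.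
    by apply: nat_invr_lt; lra.
  pose j := maxn J J'.
  have [/andP[ej0 ejd] _] := eP j.
  apply: le_trans (P_mono _ _ (2 * e j)%R _ _) _.
    have lt_d : (j.+1%:R^-1 < d / 2)%R by apply: Jd; exact: leq_maxr.
    clear -ej0 ejd lt_d; move: ej0 ejd lt_d; move: (e j) (j.+1%:R^-1)%R => a b.
    by move=> *; apply/andP; split; lra.
  by apply: le_trans (le_i _ Zx j) _; rewrite lee_fin Jt // leq_maxl.
have -> : lim (F e @[e --> (0 : R)^'+]) = L.
  apply: cvg_lim => //; apply: cvge_real_bounds => t.
    exact: L_lower.
  by rewrite -Si; exact: S_lower.
split; first by exists i.
by move=> _ [i' _ <-]; exact: L_le_S.
Unshelve. all: by end_near. Qed.
End ereal_facts.

(** * Powers of two and geometric sums *)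

Section exp2.
Local Open Scope ring_scope.
Local Open Scope ereal_scope.
Variable R : realType.
Implicit Types (a : \bar R) (b r s t : R).

Lemma exp2e_fin r : exp2e r%:E = (2 `^ r)%:E.
Proof. by rewrite /exp2e -EFinM /= /powR pnatr_eq0. Qed.

Lemma exp2e_natr n : exp2e (- n%:R%:E) = (2 ^- n)%:E :> \bar R.
Proof. by rewrite -EFinN exp2e_fin powRN powR_mulrn. Qed.

Lemma exp2e_ge0 a : 0 <= exp2e a.
Proof. exact: expeR_ge0. Qed.

Lemma ln2_gt0 : (0 < ln 2 :> R)%R.
Proof. by rewrite ln_gt0 // ltr1n. Qed.

Lemma le_exp2e : {mono @exp2e R : a b / a <= b}.
Proof.
by move=> a b; rewrite lee_expeR lee_pmul2r // ?lte_fin ln2_gt0.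
Qed.

Lemma exp2eD r a : exp2e (r%:E + a) = exp2e r%:E * exp2e a.
Proof. by rewrite /exp2e muleDl // expeRD. Qed.

Lemma rate_log2e_le n a s : (0 < n)%N -> 0 <= a ->
  ((n%:R^-1)%:E * log2e a <= s%:E) = (a <= exp2e (n%:R * s)%:E).
Proof.
move=> n0 a0; have nR : (0 < n%:R :> R)%R by rewrite ltr0n.
rewrite lee_pdivrMl // /log2e lee_pdivrMr ?ln2_gt0 //.
rewrite -[lne a <= _]lee_expeR lneK //.
by rewrite in_itv /= a0 leey.
Qed.

Lemma esum_le_mull (T : choiceType) (D : set T) (f : T -> \bar R) a :
  0 <= a -> (forall x, 0 <= f x) ->
  \esum_(x in D) (a * f x) <= a * \esum_(x in D) f x.
Proof.
move=> a0 f0; apply: ge_ereal_sup => _ [F [finF FD] <-].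
rewrite -ge0_mule_fsumr //; apply: lee_wpmul2l => //.
by apply: ereal_sup_ubound; exists F.
Qed.

Lemma geometric_tail r (M : nat) : (0 <= r < 1)%R ->
  \esum_(n in [set n | (M <= n)%N]) (r ^+ n)%:E <= (r ^+ M / (1 - r))%:E.
Proof.
move=> /andP[r0 r1]; have r10 : (0 < 1 - r)%R by rewrite subr_gt0.
have rE0 n : 0 <= (r ^+ n)%:E by rewrite lee_fin exprn_ge0.
rewrite -nneseries_esum //; apply: lime_le.
  by apply: is_cvg_nneseries_cond => n *; exact: rE0.
apply: nearW => K; rewrite sumEFin lee_fin ler_pdivlMr //.
have [KM|MK] := leqP K M.
  rewrite big_nat_cond big_pred0 ?mul0r ?exprn_ge0 // => n.
  by apply/negbTE/negP => /andP[]; lia.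
suff : ((\sum_(0 <= n < K | (M <= n)%N) r ^+ n) * (1 - r) = r ^+ M - r ^+ K)%R.
  by move=> ->; rewrite lerBlDr lerDl exprn_ge0.
rewrite -(subnKC (ltnW MK)); elim: (K - M)%N => [|k IHk].
  rewrite addn0 subrr big_nat_cond big_pred0 ?mul0r // => n.
  by apply/negbTE/negP => /andP[]; lia.
rewrite addnS big_mkcond big_nat_recr //= -big_mkcond /= leq_addr mulrDl IHk.
by rewrite exprS; ring.
Qed.

(** A gain of n (t - s) bits at each time n makes the families of all large
times together as light as one likes. *)
Lemma space_time_sum (X : choiceType) (E : nat -> set X)
    (f : X -> nat -> \bar R) s t (N0 : nat) :
  (s < t)%R ->
  (forall n, (N0 <= n)%N ->
    \esum_(y in E n) exp2e (f y n) <= exp2e (n%:R * s)%:E) ->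
  forall d, (0 < d)%R -> exists N, forall M, (N <= M)%N ->
    \esum_(c in [set c : X * nat | (M <= c.2)%N /\ E c.2 c.1])
       exp2e ((- (c.2%:R * t))%:E + f c.1 c.2) <= d%:E.
Proof.
move=> st Ef d d0; pose q := (2 `^ (s - t) : R)%R.
have q0 : (0 <= q)%R by exact: powR_ge0.
have q1 : (q < 1)%R.
  by rewrite /q /powR pnatr_eq0 /= expR_lt1 pmulr_llt0 ?ln2_gt0 // subr_lt0.
have [N qN] : exists N, forall M, (N <= M)%N -> (q ^+ M <= d * (1 - q))%R.
  have /cvgrPdist_le/(_ (d * (1 - q))%R) : (q ^+ n)%R @[n --> \oo] --> (0 : R)%R.
    by apply: cvg_expr; rewrite ger0_norm.
  rewrite mulr_gt0 ?subr_gt0 // => /(_ isT)[N _ qN]; exists N => M NM.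
  by have := qN M NM; rewrite /= sub0r normrN ger0_norm // exprn_ge0.
exists (maxn N N0) => M; rewrite geq_max => /andP[NM N0M].
set g := fun n y => exp2e ((- (n%:R * t))%:E + f y n).
rewrite (reindex_esum ([set n | (M <= n)%N] `*`` E) _ (fun c => (c.2, c.1)));
  last first.
  split=> [[n y] //|[n y] [m z] _ _ [-> ->] //|[y n] /= [Mn Ey]].
  by exists (n, y).
rewrite -(@esum_esum _ _ _ _ _ g); last by move=> *; exact: exp2e_ge0.
apply: (@le_trans _ _ (\esum_(n in [set n | (M <= n)%N]) (q ^+ n)%:E)).
  apply: le_esum => n /= Mn.
  under eq_esum do rewrite /g exp2eD.
  apply: (le_trans (esum_le_mull _ _ _)).
  - exact: exp2e_ge0.
  - by move=> y; exact: exp2e_ge0.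
  apply: (le_trans (lee_wpmul2l (exp2e_ge0 _) (Ef n (leq_trans N0M Mn)))).
  rewrite !exp2e_fin -EFinM lee_fin -powRD ?pnatr_eq0 ?implybT //.
  by rewrite -powR_mulrn // -powRrM -mulrN -mulrDr addrC mulrC.
apply: (le_trans (geometric_tail _ _)); first by rewrite q0.
by rewrite lee_fin ler_pdivrMr ?subr_gt0 // qN.
Qed.

(** An additive constant is absorbed by any gain in the rate. *)
Lemma eventually_affine_le s b t : (s < t)%R ->
  exists N, forall n, (N <= n)%N -> (0 < n)%N /\ (n%:R * s + b <= n%:R * t)%R.
Proof.
move=> st; exists (Num.truncn (b / (t - s))%R).+1 => m Nm; split; first by lia.
have : (b / (t - s) <= m%:R)%R.
  by apply: le_trans (ltW (truncnS_gt _)) _; rewrite ler_nat.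
by rewrite ler_pdivrMr ?subr_gt0 //; lra.
Qed.

Lemma countable_space_time (X : Type) (E : nat -> set X) (M : nat) :
  (forall n, (M <= n)%N -> countable (E n)) ->
  countable [set c : X * nat | (M <= c.2)%N /\ E c.2 c.1].
Proof.
move=> E_countable.
have -> : [set c : X * nat | (M <= c.2)%N /\ E c.2 c.1] =
    \bigcup_(n in [set n | (M <= n)%N]) [set (y, n) | y in E n].
  apply/seteqP; split=> [[y n] [/= Mn ny]|_ [n Mn [y ny <-]]] //.
  by exists n => //; exists y.
apply: bigcup_countable => [|n Mn]; first exact: countableP.
exact: sub_countable (card_image_le _ _) (E_countable n Mn).
Qed.
End exp2.

(** * Bowen balls and Birkhoff sums *)

Section dynamics.
Local Open Scope ring_scope.
Context {R : realType} {X : completeMetricType R}.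
Variables (T : X -> X) (phi : X -> R).
Implicit Types (x y z : X) (e : R) (n : nat).

Lemma bowen_ball_sym n x y e :
  bowen_ball n x T e y -> bowen_ball n y T e x.
Proof. by move=> xy i /xy; rewrite metric_sym. Qed.

Lemma bowen_ball_double n x y z e :
  bowen_ball n y T e x -> bowen_ball n y T e z -> bowen_ball n x T (2 * e) z.
Proof.
move=> yx yz i i_n; apply: le_lt_trans (metric_triangle _ (iter i T y) _) _.
by rewrite metric_sym; have := yx i i_n; have := yz i i_n; lra.
Qed.

Lemma bowen_ball_le n x e e' : e <= e' ->
  bowen_ball n x T e `<=` bowen_ball n x T e'.
Proof. by move=> ee' y xy i /xy lt_e; exact: lt_le_trans ee'. Qed.

Lemma bowen_ball_center n x e : 0 < e -> bowen_ball n x T e x.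
Proof. by move=> e0 i _; rewrite mdistxx. Qed.

Lemma nbhs_bowen_ball n x e : continuous T -> 0 < e ->
  nbhs x (bowen_ball n x T e).
Proof.
move=> T_cont e0.
have Ti i : {for x, continuous (iter i T)}.
  elim: i => [|i IHi] /=; first exact: cvg_id.
  exact: continuous_comp IHi (T_cont _).
suff : \forall y \near x, forall i : 'I_n,
    mdist (iter i T x) (iter i T y) < e.
  by apply: filterS => y xy i i_n; exact: (xy (Ordinal i_n)).
apply: filter_forall => i.
have := Ti i _ (nbhsx_ballx (iter i T x) e e0).
by rewrite ballEmdist.
Qed.

Lemma dense_bowen_ball (xs : nat -> X) n x e : dense (range xs) ->
  continuous T -> 0 < e -> exists i, bowen_ball n x T e (xs i).
Proof.
move=> xs_dense T_cont e0.
have x_in := nbhs_interior (nbhs_bowen_ball n x T_cont e0).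
have [y [By [i _ xi]]] := xs_dense _ (ex_intro _ x (nbhs_singleton x_in))
  (@open_interior _ _).
by exists i; rewrite xi; exact: interior_subset By.
Qed.

Lemma birkhoff_le_sup_sum n x y e : bowen_ball n x T e y ->
  ((birkhoff_sum T phi n y)%:E <= sup_sum T phi x n e)%E.
Proof. by move=> xy; apply: ereal_sup_ubound; exists y. Qed.

Lemma sup_sum_le : unif_continuous phi -> forall d, 0 < d ->
  \forall e \near 0^'+, forall n x,
    (sup_sum T phi x n e <= (n%:R * d)%:E + (birkhoff_sum T phi n x)%:E)%E.
Proof.
move=> /unif_continuousP phi_unif d d0; have [r r0 phir] := phi_unif _ d0.
near=> e => n x; apply: ge_ereal_sup => _ [y xy <-].
rewrite -EFinD lee_fin /birkhoff_sum -lerBlDr -sumrB.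
have -> : n%:R * d = \sum_(0 <= k < n) d by rewrite sumr_const_nat subn0 mulr_natl.
apply: ler_sum_nat => k /andP[_ k_n].
have lt_r : mdist (iter k T x) (iter k T y) < r.
  by apply: lt_le_trans (xy k k_n) _; near: e; exact: nbhs_right_le.
have := phir (iter k T x, iter k T y); rewrite ballEmdist => /(_ lt_r).
by rewrite -ball_normE /= ltr_norml => /andP[+ _]; lra.
Unshelve. all: by end_near. Qed.

End dynamics.

(** * Kolmogorov complexity *)

Section kolmogorov.
Local Open Scope ring_scope.
Local Open Scope ereal_scope.
Context {R : realType}.
Variables (U : recfun) (A : set nat).

Lemma kolmogorov_le p s : run U A p s ->
  kolmogorov R U A s <= (size p)%:R%:E.
Proof. by move=> ps; apply: ereal_inf_lbound; exists p. Qed.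

Lemma kolmogorov_lt s (b : R) : kolmogorov R U A s < b%:E ->
  exists2 p, run U A p s & ((size p)%:R < b)%R.
Proof. by move=> /ereal_inf_lt[_ [p ps <-]]; exists p. Qed.

(** A point y with K(i) + S y < t has weight 2^(S y) at most 2^t times the
weight 2^-K(i) of a program of its index, and the programs of distinct points
are not comparable. *)
Lemma cheap_points_weight_le (X : choiceType) (xs : nat -> X) (S : X -> R) (t : R) :
  prefix_free_machine U ->
  \esum_(y in [set xs i | i in
      [set i | kolmogorov_nat R U A i + (S (xs i))%:E < t%:E]])
    exp2e (S y)%:E <= exp2e t%:E.
Proof.
move=> U_pf; set D := [set xs i | i in _].
have /choice[f fP] y : exists f : nat * seq bool, D y ->
    [/\ xs f.1 = y, run U A f.2 (bits_of_nat f.1)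
      & ((size f.2)%:R + S y < t)%R].
  have [[i /= + <-]|nDy] := pselect (D y); last by exists (0%N, [::]).
  rewrite -lteBrDr // -EFinB => /kolmogorov_lt[p pi lt_p].
  by exists (i, p) => _; split; [| |move: lt_p; rewrite ltrBrDr].
have pf : {in D &, forall y z, prefix (f y).2 (f z).2 -> y = z}.
  move=> y z /set_mem/fP[ey ry _] /set_mem/fP[ez rz _] pyz.
  move: (ry); rewrite (U_pf _ _ _ _ _ ry rz pyz) => {}ry.
  have /nat_of_bits_inj/(can_inj bits_of_natK) yz :=
    Defs.eval_functional ry rz.
  by rewrite -ey yz ez.
apply: (@le_trans _ _ (\esum_(y in D) (exp2e t%:E * (2 ^- size (f y).2)%:E))).
  apply: le_esum => y /fP[_ _ lt_t].
  rewrite -exp2e_natr -exp2eD le_exp2e -EFinN -EFinD lee_fin; lra.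
apply: (le_trans (esum_le_mull _ _ _)).
- exact: exp2e_ge0.
- by move=> y; rewrite lee_fin.
by rewrite -[leRHS]mule1 lee_wpmul2l ?exp2e_ge0 // kraft_inequality.
Qed.
End kolmogorov.

(** * From descriptions to covers *)

Section pressures.
Local Open Scope ring_scope.
Local Open Scope ereal_scope.
Context {R : realType} {X : completeMetricType R}.
Variables (xs : nat -> X) (T : X -> X) (phi : X -> R) (U : recfun).
Hypothesis U_univ : universal_machine U.
Implicit Types (x y z : X) (Z : set X) (e s t : R) (n N : nat) (A : set nat).

Lemma spanning_sum_ge0 Z n e : 0 <= spanning_sum Z T phi n e.
Proof.
by apply: le_ereal_inf_tmp => _ [E _ <-]; apply: esum_ge0 => *; exact: exp2e_ge0.
Qed.

Lemma point_rate_mono A x e e' n : (e <= e')%R ->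
  point_rate U A xs x T phi e' n <= point_rate U A xs x T phi e n.
Proof.
move=> ee'; apply: ereal_inf_le_tmp => _ [i xi <-]; exists i => //.
exact: bowen_ball_le xi.
Qed.

Lemma lower_point_pressure_at_mono A x e e' : (e <= e')%R ->
  lower_point_pressure_at U A xs x T phi e' <=
  lower_point_pressure_at U A xs x T phi e.
Proof.
move=> ee'; apply: ereal_le_real => t /limn_einf_lt lt_t.
apply: limn_einf_le => N; have [n Nn le_t] := lt_t N; exists n => //.
exact: le_trans (point_rate_mono _ _ _ ee') (ltW le_t).
Qed.

Lemma upper_point_pressure_at_mono A x e e' : (e <= e')%R ->
  upper_point_pressure_at U A xs x T phi e' <=
  upper_point_pressure_at U A xs x T phi e.
Proof.
move=> ee'; apply: ereal_le_real => t /limn_esup_lt[N lt_t].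
apply: (@limn_esup_le _ _ _ N) => n Nn.
exact: le_trans (point_rate_mono _ _ _ ee') (ltW (lt_t n Nn)).
Qed.

Lemma point_rate_le A x e n i t : (0 < n)%N -> bowen_ball n x T e (xs i) ->
  kolmogorov_nat R U A i + (birkhoff_sum T phi n (xs i))%:E <= (n%:R * t)%:E ->
  point_rate U A xs x T phi e n <= t%:E.
Proof.
move=> n0 xi le_t; apply: (le_trans (ereal_inf_lbound _)); first by exists i.
by rewrite lee_pdivrMr ?ltr0n // -EFinM mulrC.
Qed.

Definition cheap A n t : set X :=
  [set xs i | i in [set i |
    kolmogorov_nat R U A i + (birkhoff_sum T phi n (xs i))%:E < (n%:R * t)%:E]].

Lemma countable_cheap A n t : countable (cheap A n t).
Proof. exact: sub_countable (card_image_le _ _) (countableP _). Qed.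

Lemma cheap_of_point_rate_lt A x e n t : (0 < n)%N ->
  point_rate U A xs x T phi e n < t%:E ->
  exists2 y, cheap A n t y & bowen_ball n y T e x.
Proof.
move=> n0 /ereal_inf_lt[_ [i xi <-]].
rewrite lte_pdivrMr ?ltr0n // -EFinM mulrC => lt_t.
by exists (xs i); [exists i|exact: bowen_ball_sym].
Qed.

Lemma cheap_sup_sum_weight_le A n e s (d : R) :
  (forall y, sup_sum T phi y n e <=
     (n%:R * d)%:E + (birkhoff_sum T phi n y)%:E) ->
  \esum_(y in cheap A n s) exp2e (sup_sum T phi y n e) <=
  exp2e (n%:R * (s + d))%:E.
Proof.
move=> sup_le.
apply: (@le_trans _ _ (\esum_(y in cheap A n s)
    (exp2e (n%:R * d)%:E * exp2e (birkhoff_sum T phi n y)%:E))).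
  by apply: le_esum => y _; rewrite -exp2eD le_exp2e.
apply: (le_trans (esum_le_mull _ _ _)).
- exact: exp2e_ge0.
- by move=> y; exact: exp2e_ge0.
rewrite mulrDr addrC EFinD exp2eD lee_wpmul2l ?exp2e_ge0 //.
exact: cheap_points_weight_le U_univ.1.
Qed.

Hypothesis phi_unif : unif_continuous phi.

(** Cover Z by the balls around the cheap points of all times n >= M: each x
in Z is seen at infinitely many times. *)
Lemma lower_pressure_at_le Z A s t : (s < t)%R ->
  (forall x e, Z x -> (0 < e)%R ->
     lower_point_pressure_at U A xs x T phi e < s%:E) ->
  \forall e \near (0 : R)^'+, lower_pressure_at Z T phi e <= t%:E.
Proof.
move=> st lt_s; pose d := ((t - s) / 2)%R; have d0 : (0 < d)%R by rewrite /d; lra.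
near=> e; have e0 : (0 < e)%R by near: e; exact: nbhs_right_gt.
have sup_le : forall n y, sup_sum T phi y n e <=
     (n%:R * d)%:E + (birkhoff_sum T phi n y)%:E.
  by near: e; exact: sup_sum_le.
apply: ereal_inf_lbound; exists t => //.
suff level0 N : mP_level Z t T phi N e = 0.
  by rewrite /= /mP (_ : mP_level Z t T phi ^~ e = cst 0) ?lim_cst //;
    apply/funext => N; exact: level0.
apply/le_anti/andP; split; last first.
  apply: le_ereal_inf_tmp => _ [C _ <-]; apply: esum_ge0 => c _.
  exact: exp2e_ge0.
apply/lee_addgt0Pr => r r0; rewrite add0e.
have sdt : (s + d < t)%R by rewrite /d; lra.
have [M0 M0r] := @space_time_sum _ _ (cheap A ^~ s)
  (fun y n => sup_sum T phi y n e) _ _ 0%N sdt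
  (fun n _ => cheap_sup_sum_weight_le A s (sup_le n)) r r0.
(* At time 0 the rate is 0 and says nothing about the cost. *)
pose M := maxn (maxn M0 N) 1.
apply: le_trans (M0r M _); last by rewrite /M; lia.
apply: ereal_inf_lbound; exists [set c | (M <= c.2)%N /\ cheap A c.2 s c.1] => //.
split.
- apply: (@countable_space_time _ (cheap A ^~ s)) => n _.
  exact: countable_cheap.
- by move=> c [Mc _]; rewrite /M in Mc; lia.
- move=> x Zx; have [n Mn] := limn_einf_lt (lt_s x e Zx e0) M.
  move=> /cheap_of_point_rate_lt[|y ny yx]; first by rewrite /M in Mn; lia.
  by exists (y, n).
Unshelve. all: by end_near. Qed.

(** Split Z according to the time from which on x is seen at all times; each
piece is covered, at a single time n, by the balls around the cheap points. *)
Lemma P_mUC_le Z A s t : (s < t)%R ->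
  (forall x e, Z x -> (0 < e)%R ->
     upper_point_pressure_at U A xs x T phi e < s%:E) ->
  \forall e \near (0 : R)^'+, P_mUC Z T phi e <= t%:E.
Proof.
move=> st lt_s; pose d := (t - s)%R; have d0 : (0 < d)%R by rewrite /d; lra.
near=> e; have e0 : (0 < e)%R by near: e; exact: nbhs_right_gt.
have sup_le : forall n y, sup_sum T phi y n e <=
     (n%:R * d)%:E + (birkhoff_sum T phi n y)%:E.
  by near: e; exact: sup_sum_le.
pose Zs N := [set x | forall n, (N < n)%N ->
  exists2 y, cheap A n s y & bowen_ball n y T e x].
apply: (@le_trans _ _ (ereal_sup (range (fun N => P_UC (Zs N) T phi e)))).
  apply: ereal_inf_lbound; exists Zs => // x Zx.
  have [N ltN] := limn_esup_lt (lt_s x e Zx e0); exists N => // n Nn.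
  apply: cheap_of_point_rate_lt; first by lia.
  by apply: ltN; lia.
apply: ge_ereal_sup => _ [N _ <-]; apply: (@limn_esup_le _ _ _ N.+1) => n Nn.
rewrite rate_log2e_le ?spanning_sum_ge0 //; last by lia.
have -> : t = (s + d)%R by rewrite /d; lra.
apply: le_trans (cheap_sup_sum_weight_le A s (sup_le n)).
apply: ereal_inf_lbound; exists (cheap A n s) => //.
split; first exact: countable_cheap.
by move=> x /(_ n Nn)[y ny yx]; exists y.
Unshelve. all: by end_near. Qed.

(** * From covers to an oracle *)

Hypotheses (xs_dense : dense (range xs)) (T_cont : continuous T).

(** The balls of all families are the codewords of one table. The k-th family
has weight at most 2^-(pickle k + 2), so the total weight is at most 1/2, as
[prefix_code_exists] requires. The constant b, which does not depend on k, is
the cost of simulating the table machine by U, plus one bit for rounding the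
lengths up. *)
Lemma oracle_for_covers (I : countType) (s e : I -> R)
    (C : I -> set (X * nat)) :
  (forall k, (0 < e k)%R) ->
  (forall k, countable (C k)) ->
  (forall k, \esum_(c in C k)
     exp2e ((- (c.2%:R * s k))%:E + sup_sum T phi c.1 c.2 (e k)) <=
     (2^-1 ^+ (choice.pickle k + 2))%:E) ->
  exists A (b : R), forall k c, C k c ->
    exists2 i, bowen_ball c.2 c.1 T (e k) (xs i) &
      kolmogorov_nat R U A i + (birkhoff_sum T phi c.2 (xs i))%:E <=
      (c.2%:R * s k + b)%:E.
Proof.
move=> e0 C_countable C_sum.
pose cost (w : I * (X * nat)) :=
  (- (w.2.2%:R * s w.1))%:E + sup_sum T phi w.2.1 w.2.2 (e w.1).
pose D := [set: I] `*`` C.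
have ex0 k c : 0 <= exp2e (cost (k, c)) by exact: exp2e_ge0.
have cost_fin w : D w -> exists2 r : R, cost w = (- r)%:E & (0 <= r)%R.
  case: w => k c [_ /= Ckc].
  have : cost (k, c) <= 0.
    rewrite -le_exp2e -[exp2e 0]/(exp2e (0%:E : \bar R)) exp2e_fin powRr0.
    apply: le_trans (le_trans (C_sum k) _); last first.
      by rewrite lee_fin exprn_ile1 // ?invr_ge0 // invf_le1 // ler1n.
    apply: esum_ge; exists [set c].
      by split; [exact: finite_set1|move=> _ ->].
    by rewrite fsbig_set1.
  have : -oo < cost (k, c).
    apply: lt_le_trans (leeD2l _ (birkhoff_le_sup_sum _ _)); last first.
      exact: bowen_ball_center (e0 k).
    by rewrite -EFinD ltNyr.
  case: (cost _) => [r _ r0| |] //; exists (- r)%R; rewrite ?opprK //.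
  by move: r0; rewrite lee_fin; lra.
have /choice[r rP] w : exists r : R,
    D w -> cost w = (- r)%:E /\ (0 <= r)%R.
  have [/cost_fin[r ? ?]|?] := pselect (D w); first by exists r.
  by exists 0%R.
pose l w := (Num.truncn (r w)).+1.
have l_ge w : ((r w) <= (l w)%:R)%R by exact/ltW/truncnS_gt.
have l_le w : D w -> ((l w)%:R <= r w + 1)%R.
  by move=> /rP[_ r0]; rewrite /l -addn1 natrD lerD2r truncn_le.
have sum_l : \esum_(w in D) (2 ^- l w : R)%:E <= (2^-1)%:E.
  apply: (@le_trans _ _ (\esum_(w in D) exp2e (cost w))).
    apply: le_esum => w /rP[-> _].
    by rewrite -exp2e_natr le_exp2e -EFinN lee_fin lerN2.
  rewrite -(@esum_esum _ _ _ _ C (fun k c => exp2e (cost (k, c)))) //.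
  apply: (@le_trans _ _ (\esum_(k in [set: I])
      (2^-1 ^+ (choice.pickle k + 2) : R)%:E)).
    by apply: le_esum => k _; exact: C_sum.
  rewrite -(@esum_image R _ _ [set: I] (fun k => choice.pickle k + 2)%N
    (fun n => (2^-1 ^+ n)%:E)); last first.
    by move=> k k' _ _ /addIn/(pcan_inj choice.pickleK).
  apply: (@le_trans _ _ (\esum_(n in [set n | (2 <= n)%N])
      (2^-1 ^+ n : R)%:E)).
    by apply: subset_esum => _ [k _ <-] /=; rewrite leq_addl.
  apply: (le_trans (geometric_tail _ _)); first lra.
  by rewrite (_ : (_ / _)%R = 2^-1%R) //; field.
have D_countable : countable D.
  have -> : D = \bigcup_(k in [set: I]) [set (k, c) | c in C k].
    apply/seteqP; split=> [[k c] [_ /= Ckc]|_ [k _ [c Ckc <-]]] //.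
    by exists k => //; exists c.
  apply: bigcup_countable => [|k _]; first exact: countableP.
  exact: sub_countable (card_image_le _ _) (C_countable k).
have [p [p_size p_pf]] := prefix_code_exists D_countable sum_l.
(* [sup_sum] bounds the Birkhoff sum at any point of the ball, in particular
   at the dense point chosen here. *)
have /choice[v vP] (w : I * (X * nat)) :
    exists i, bowen_ball w.2.2 w.2.1 T (e w.1) (xs i).
  exact: dense_bowen_ball.
have [q qP] := U_univ.2 _ table_machine_prefix_free.
exists (table_oracle D p v), ((size q)%:R + 1)%R => k c Ckc.
have Dw : D (k, c) by [].
exists (v (k, c)); first exact: (vP (k, c)).
have run_v := run_table_machine v p_pf (mem_set Dw).
have := kolmogorov_le (R := R) ((qP _ _ _).2 run_v).
rewrite size_cat p_size // natrD => K_le.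
have S_le := birkhoff_le_sup_sum phi (vP (k, c)).
have [cE _] := rP _ Dw; have := l_le _ Dw.
move: S_le cE; rewrite /cost /=.
case: (sup_sum _ _ _ _ _) => [S| |] //=; rewrite lee_fin => S_le [cE] lw.
apply: (le_trans (leeD K_le (lexx _))).
by rewrite -EFinD lee_fin; lra.
Qed.

Lemma mP_level_nondecreasing Z s e :
  nondecreasing_seq (fun N => mP_level Z s T phi N e).
Proof.
move=> N N' NN'; apply: ereal_inf_le_tmp => _ [C [C0 CN CZ] <-].
by exists C => //; split=> // c /CN; exact: leq_trans.
Qed.

(** The families are indexed by the pairs (j, N): for each j, there must be
balls of arbitrarily large times that contain x. *)
Lemma oracle_lower_pressure Z (s e : nat -> R) :
  (forall j, (0 < e j)%R) ->
  (forall j, lower_pressure_at Z T phi (e j) < (s j)%:E) ->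
  exists A, forall x, Z x -> forall j,
    lower_point_pressure_at U A xs x T phi (2 * e j) <= (s j)%:E.
Proof.
move=> e0 lt_s.
have /choice[s' s'P] j : exists s' : R,
    mP Z s' T phi (e j) = 0 /\ (s' < s j)%R.
  by have /ereal_inf_lt[_ [s' /= mP0 <-] lt_s'] := lt_s j; exists s'.
have /choice[C CP] (k : nat * nat) : exists C,
    bowen_covers Z T k.2 (e k.1) C /\
    \esum_(c in C)
      exp2e ((- (c.2%:R * s' k.1))%:E + sup_sum T phi c.1 c.2 (e k.1)) <=
      (2^-1 ^+ (choice.pickle k + 2))%:E.
  have : mP_level Z (s' k.1) T phi k.2 (e k.1) <
      (2^-1 ^+ (choice.pickle k + 2) : R)%:E.
    apply: (@le_lt_trans _ _ 0); last by rewrite lte_fin exprn_gt0 // invr_gt0.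
    rewrite -(s'P k.1).1 /mP.
    rewrite (cvg_lim _ (ereal_nondecreasing_cvgn
      (@mP_level_nondecreasing Z (s' k.1) (e k.1)))) //.
    by apply: ereal_sup_ubound; exists k.2.
  by move=> /ereal_inf_lt[_ [C CZ <-] ltC]; exists C; split=> //; exact: ltW.
have [A [b AP]] := oracle_for_covers (fun k : nat * nat => e0 k.1)
  (fun k => let: And3 c _ _ := (CP k).1 in c) (fun k => (CP k).2).
exists A => x Zx j; apply: ereal_le_real => t.
rewrite lte_fin => /(lt_trans (s'P j).2) /(eventually_affine_le b)[M MP].
apply: limn_einf_le => N; pose k := (j, maxn M N).
have [_ C_ge /(_ x Zx)[c Cc cx]] := (CP k).1.
have le_c : (maxn M N <= c.2)%N := C_ge c Cc.
exists c.2; first by lia.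
have [c0 le_t] : (0 < c.2)%N /\ (c.2%:R * s' j + b <= c.2%:R * t)%R.
  by apply: MP; lia.
have [i ci le_i] := AP k c Cc.
apply: (point_rate_le c0 (bowen_ball_double cx ci)).
by apply: (le_trans le_i); rewrite lee_fin.
Qed.

(** The families are indexed by the pairs (j, i), where i numbers the pieces of
a cover of Z at radius e_j; the (j, i)-th family covers the i-th piece at every
large time. *)
Lemma oracle_P_mUC Z (s e : nat -> R) :
  (forall j, (0 < e j)%R) ->
  (forall j, P_mUC Z T phi (e j) < (s j)%:E) ->
  exists A, forall x, Z x -> forall j,
    upper_point_pressure_at U A xs x T phi (2 * e j) <= (s j)%:E.
Proof.
move=> e0 lt_s.
(* The cover of Z and two rates between its pressure and [s j]: the first one
   makes the spanning sums small, the second one the sum over all times. *)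
have /choice[f fP] j : exists f : (nat -> set X) * R * R,
    [/\ Z `<=` \bigcup_i f.1.1 i, (f.1.2 < f.2)%R, (f.2 < s j)%R &
      forall i, P_UC (f.1.1 i) T phi (e j) < f.1.2%:E].
  have /ereal_inf_lt[_ [Zs ZsP <-] /ereal_lt_dense[r ltr rs]] := lt_s j.
  have /ereal_lt_dense[r' rr' r's] := rs.
  exists (Zs, r, r'); split=> // i.
  by apply: le_lt_trans ltr; apply: ereal_sup_ubound; exists i.
have /choice[E EP] (k : nat * nat) : exists E : nat * (nat -> set X),
    forall n, (E.1 <= n)%N ->
    [/\ countable (E.2 n),
        (f k.1).1.1 k.2 `<=` \bigcup_(y in E.2 n) bowen_ball n y T (e k.1) &
        \esum_(y in E.2 n) exp2e (sup_sum T phi y n (e k.1)) <=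
        exp2e (n%:R * (f k.1).2)%:E].
  have [_ rr' _ /(_ k.2)/limn_esup_lt[N ltN]] := fP k.1.
  suff /choice[E EP] n : exists E, (N.+1 <= n)%N -> [/\ countable E,
        (f k.1).1.1 k.2 `<=` \bigcup_(y in E) bowen_ball n y T (e k.1) &
        \esum_(y in E) exp2e (sup_sum T phi y n (e k.1)) <=
        exp2e (n%:R * (f k.1).2)%:E].
    by exists (N.+1, E).
  have [Nn|] := ltnP N n; last by exists set0; lia.
  have n0 : (0 < n)%N by lia.
  have := ltW (ltN n (ltnW Nn)).
  rewrite rate_log2e_le ?spanning_sum_ge0 //.
  move=> le_r.
  have : spanning_sum ((f k.1).1.1 k.2) T phi n (e k.1) <
      exp2e (n%:R * (f k.1).2)%:E.
    apply: (le_lt_trans le_r); rewrite ltNge le_exp2e -ltNge lte_fin.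
    by rewrite ltr_pM2l // ltr0n.
  move=> /ereal_inf_lt[_ [E [E0 EZ] <-] ltE]; exists E => _.
  by split=> //; exact: ltW.
have /choice[M MP] (k : nat * nat) : exists M, ((E k).1 <= M)%N /\
    \esum_(c in [set c : X * nat | (M <= c.2)%N /\ (E k).2 c.2 c.1])
      exp2e ((- (c.2%:R * s k.1))%:E + sup_sum T phi c.1 c.2 (e k.1)) <=
      (2^-1 ^+ (choice.pickle k + 2))%:E.
  have [_ _ r's _] := fP k.1.
  have d0 : (0 < 2^-1 ^+ (choice.pickle k + 2) :> R)%R.
    by rewrite exprn_gt0 // invr_gt0.
  have [M MP] := @space_time_sum _ _ (E k).2
    (fun y n => sup_sum T phi y n (e k.1)) _ _ (E k).1 r's
    (fun n En => let: And3 _ _ w := EP k n En in w) _ d0.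
  by exists (maxn M (E k).1); split; [lia|apply: MP; lia].
have C_countable (k : nat * nat) :
    countable [set c : X * nat | (M k <= c.2)%N /\ (E k).2 c.2 c.1].
  apply: (@countable_space_time _ (E k).2) => n Mn.
  by have [] := EP k n (leq_trans (MP k).1 Mn).
have [A [b AP]] := oracle_for_covers (fun k : nat * nat => e0 k.1)
  C_countable (fun k => (MP k).2).
exists A => x Zx j; apply: ereal_le_real => t.
rewrite lte_fin => /(eventually_affine_le b)[N NP].
have [/(_ x Zx)[i _ xi] _ _ _] := fP j; pose k := (j, i).
apply: (@limn_esup_le _ _ _ (maxn N (M k))) => n Nn.
have Mn : (M k <= n)%N by lia.
have [n0 le_t] : (0 < n)%N /\ (n%:R * s j + b <= n%:R * t)%R.
  by apply: NP; lia.
have [_ /(_ x xi)[y ny yx] _] := EP k n (leq_trans (MP k).1 Mn).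
have [i' yi' le_i'] := AP k (y, n) (conj Mn ny).
apply: (point_rate_le n0 (bowen_ball_double yx yi')).
by apply: (le_trans le_i'); rewrite lee_fin.
Qed.
End pressures.

Unset Implicit Arguments.

Theorem theorem1 (R : realType) (X : completeMetricType R) (xs : nat -> X)
    (xs_dense : dense (range xs))
    (T : X -> X) (T_cont : continuous T)
    (phi : X -> R) (phi_unif : unif_continuous phi)
    (U : recfun) (U_univ : universal_machine U) (Z : set X) :
  is_minimum
    [set ereal_sup [set lower_point_pressure U A xs x T phi | x in Z]
    | A in [set: set nat]]
    (lower_pressure Z T phi) /\
  is_minimum
    [set ereal_sup [set upper_point_pressure U A xs x T phi | x in Z]
    | A in [set: set nat]]
    (upper_pressure Z T phi).
Proof.
split.
- apply: is_minimum_lim => //; first exact: set0.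
  + by move=> A x e e' /andP[_]; exact: lower_point_pressure_at_mono.
  + by move=> s e; exact: oracle_lower_pressure.
  + by move=> A s t; exact: lower_pressure_at_le.
- apply: is_minimum_lim => //; first exact: set0.
  + by move=> A x e e' /andP[_]; exact: upper_point_pressure_at_mono.
  + by move=> s e; exact: oracle_P_mUC.
  + by move=> A s t; exact: P_mUC_le.
Qed.
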